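(* Every reduced order $A$ has a universal grading $(\Gamma,\mathbf{B})$, and its universal grading is by a finite abelian group (that is, $\Gamma$ is finite).
   Context: All rings are commutative with identity. An order is a commutative ring $A$ whose additive group is isomorphic to $\mathbb{Z}^n$ for some integer $n\ge 0$. A ring is reduced if its nilradical (the set of nilpotent elements) is $0$. Let $\Gamma$ be a multiplicatively written abelian group. A $\Gamma$-grading of a ring $A$ is a system $\mathbf{B}=(B_\gamma)_{\gamma\in\Gamma}$ of additive subgroups $B_\gamma\subset A$ such that $B_\gamma\cdot B_{\gamma'}\subset B_{\gamma\gamma'}$ for all $\gamma,\gamma'\in\Gamma$, and such that the map $\bigoplus_{\gamma\in\Gamma}B_\gamma\to A$, $(x_\gamma)_\gamma\mapsto\sum_\gamma x_\gamma$, is bijective. If $f:\Gamma\to\Delta$ is a homomorphism of abelian groups, then $f_*\mathbf{B}$ denotes the $\Delta$-grading $(\sum_{\gamma\in f^{-1}(\delta)}B_\gamma)_{\delta\in\Delta}$ of $A$. A universal grading of $A$ is a pair $(\Gamma,\mathbf{B})$ consisting of an abelian group $\Gamma$ and a $\Gamma$-grading $\mathbf{B}$ of $A$ such that for each abelian group $\Delta$ and each $\Delta$-grading $\mathbf{C}$ of $A$ there is a unique group homomorphism $f:\Gamma\to\Delta$ with $\mathbf{C}=f_*\mathbf{B}$. A universal grading, if it exists, is unique up to a unique isomorphism. *)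

(* Defs.v *)
From mathcomp Require Import all_boot all_order all_algebra.
From mathcomp Require Import finmap.
From mathcomp Require Import boolp classical_sets functions cardinality.

Set Implicit Arguments.
Unset Strict Implicit.
Unset Printing Implicit Defensive.

Import GRing.Theory.
Local Open Scope classical_set_scope.
Local Open Scope ring_scope.

(* [comPzRingType] rather than [comNzRingType]: the zero ring is an order,
   with n = 0. *)
Definition is_order (A : comPzRingType) : Prop :=
  exists (n : nat) (phi : {additive A -> 'rV[int]_n}), bijective phi.

Definition nilradical (A : comPzRingType) : set A :=
  [set a | exists n : nat, a ^+ n = 0].

Arguments nilradical : clear implicits.

Definition reduced (A : comPzRingType) : Prop := nilradical A = [set 0].

Section Gradings.
Variables (A : comPzRingType) (Gamma : zmodType).
Implicit Types (B : Gamma -> set A).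

(* Finitely supported families (x_gamma) with x_gamma in B_gamma, i.e. the
   elements of the external direct sum of the B_gamma. *)
Definition direct_sum B : set {fsfun Gamma -> A with 0} :=
  [set x | forall gamma, B gamma (x gamma)].

Definition fsfun_sum (x : {fsfun Gamma -> A with 0}) : A :=
  \sum_(gamma <- finsupp x) x gamma.

(* The grading group, multiplicative in the literature, is a [zmodType], so
   that the degree of a product is the sum of the degrees. *)
Record is_grading B : Prop := IsGrading {
  grading_subgroup : forall gamma, zmod_closed [in B gamma];
  grading_mul : forall gamma gamma' (x y : A),
    B gamma x -> B gamma' y -> B (gamma + gamma') (x * y);
  grading_bij : set_bij (direct_sum B) [set: A] fsfun_sum
}.

(* The sum of the subgroups B_gamma for gamma in I; I may be infinite. *)
Definition sum_over (I : set Gamma) B : set A :=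
  fsfun_sum @` [set x | direct_sum B x /\ {in finsupp x, forall gamma, I gamma}].

End Gradings.

Definition pushforward (A : comPzRingType) (Gamma Delta : zmodType)
    (f : Gamma -> Delta) (B : Gamma -> set A) : Delta -> set A :=
  fun delta => sum_over (f @^-1` [set delta]) B.

Definition is_universal_grading (A : comPzRingType) (Gamma : zmodType)
    (B : Gamma -> set A) : Prop :=
  is_grading B /\
  forall (Delta : zmodType) (C : Delta -> set A), is_grading C ->
    exists f : {additive Gamma -> Delta},
      C = pushforward f B /\
      forall g : {additive Gamma -> Delta}, C = pushforward g B -> g =1 f.

(* Main.v *)
(* A reduced order A has ring homomorphisms s_1, ..., s_n : A -> C, the joint
   eigenvalues of its commuting, diagonalizable multiplication matrices, and
   (x, y) |-> sum_i s_i(x) conj(s_i(y)) is a positive definite form for which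
   nonzero elements have norm at least 1. The degrees occurring in a grading are
   torsion, since A is reduced and has finite rank. Elements x, y of distinct
   degrees are orthogonal: conj(s_i(y)) = s_i(y') for some y' in A (x) C whose
   degree is inverse to that of y, and x y' has trace 0, being of nontrivial
   degree. By descent on the norm, splitting an element into orthogonal
   components, A is therefore generated by finitely many elements that are
   homogeneous in every grading. The universal grading group is the abelian
   group on these generators modulo the relations between their degrees that
   hold in all gradings. It is finite: the quotient map by the finite subgroup
   generated by the occurring degrees and the zero map push the universal grading
   forward to the same trivial grading, so they agree. *)
Require Import Defs.
From HB Require Import structures.
From mathcomp Require Import all_boot all_order all_algebra all_field zify ring.
From mathcomp Require Import generic_quotient ring_quotient.
From mathcomp Require Import finmap.
From mathcomp Require Import boolp classical_sets functions cardinality.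

Set Implicit Arguments.
Unset Strict Implicit.
Unset Printing Implicit Defensive.

Import Order.TTheory GRing.Theory Num.Theory.
Local Open Scope classical_set_scope.
Local Open Scope quotient_scope.
Local Open Scope ring_scope.

(** * Quotients of abelian groups *)

Lemma zmod_quotient (V : zmodType) (N : set V) : zmod_closed [in N] ->
  exists (Q : zmodType) (p : {additive V -> Q}),
    (forall q, exists v, p v = q) /\ forall v, p v = 0 <-> N v.
Proof.
move=> Ncl.
pose S : zmodClosed V := HB.pack [in N] (GRing.isZmodClosed.Build V [in N] Ncl).
pose Q := Quotient.quot S.
exists Q, (\pi_Q : {additive V -> Q}); split=> [q|v].
  by exists (repr q); exact: reprK.
suff -> : (\pi_Q v = 0) <-> (v - 0 \in S) by rewrite subr0 inE.
by rewrite Quotient.idealrBE -[X in _ = X](raddf0 \pi_Q); split=> /eqP.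
Qed.

Lemma additive_factor (V Q W : zmodType) (p : {additive V -> Q})
    (h : {additive V -> W}) :
  (forall q, exists v, p v = q) -> (forall v, p v = 0 -> h v = 0) ->
  exists f : {additive Q -> W}, forall v, f (p v) = h v.
Proof.
move=> psurj ph0; have [r rK] := choice psurj.
have hE u v : p u = p v -> h u = h v.
  by move=> puv; apply/eqP; rewrite -subr_eq0 -raddfB ph0 // raddfB puv subrr.
have fB : zmod_morphism (h \o r).
  by move=> x y /=; rewrite -raddfB; apply: hE; rewrite raddfB !rK.
pose f : {additive Q -> W} :=
  HB.pack (h \o r) (GRing.isZmodMorphism.Build Q W (h \o r) fB).
by exists f => v; apply: hE; rewrite rK.
Qed.

(** * Gradings in terms of lists and projections *)

Section GradingCriteria.
Variables (A : comPzRingType) (G : zmodType).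
Implicit Types (B : G -> set A) (x : {fsfun G -> A with 0}) (D : seq G).

Lemma fsfun_sumE x D : uniq D -> {subset finsupp x <= D} ->
  fsfun_sum x = \sum_(g <- D) x g.
Proof.
move=> uD sxD; rewrite /fsfun_sum [RHS](bigID [in finsupp x]) /=.
rewrite [X in _ = _ + X]big1 => [|g gx]; last by rewrite fsfun_dflt.
rewrite addr0 -[RHS]big_filter; apply: perm_big.
apply: uniq_perm => [||g]; rewrite ?fset_uniq ?filter_uniq //.
by rewrite mem_filter andb_idr //; apply: sxD.
Qed.

Lemma fsfun_of_seq D (c : G -> A) : uniq D ->
  exists x, (forall g, x g = if g \in D then c g else 0) /\
            fsfun_sum x = \sum_(g <- D) c g.
Proof.
move=> uD; pose x : {fsfun G -> A with 0} := [fsfun g in seq_fset tt D => c g].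
have xE g : x g = if g \in D then c g else 0.
  by rewrite fsfunE seq_fsetE.
exists x; split=> //; rewrite (@fsfun_sumE _ D) // => [|g].
  by rewrite !big_seq; apply: eq_bigr => g gD; rewrite xE gD.
by rewrite mem_finsupp xE; case: ifP; rewrite ?eqxx.
Qed.

Lemma zmod_closed0 (V : zmodType) (S : set V) : zmod_closed [in S] -> S 0.
Proof. by case=> + _; rewrite inE. Qed.

Lemma zmod_closed_sub (V : zmodType) (S : set V) (u v : V) :
  zmod_closed [in S] -> S u -> S v -> S (u - v).
Proof. by move=> [_ SB] Su Sv; have := SB u v; rewrite !inE; apply. Qed.

Lemma zmod_closedP (V : zmodType) (S : set V) :
  S 0 -> (forall u v, S u -> S v -> S (u - v)) -> zmod_closed [in S].
Proof. by move=> S0 SB; split=> [|u v]; rewrite !inE //; apply: SB. Qed.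

Lemma zmod_closed_sum (V : zmodType) (S : set V) (I : Type) (r : seq I)
    (P : pred I) (F : I -> V) :
  zmod_closed [in S] -> (forall i, P i -> S (F i)) ->
  S (\sum_(i <- r | P i) F i).
Proof.
move=> Scl SF; apply: (big_ind S) => // [|u v Su Sv].
  exact: zmod_closed0.
rewrite -[v]opprK; apply: zmod_closed_sub => //.
by rewrite -sub0r; apply: zmod_closed_sub => //; apply: zmod_closed0.
Qed.

Lemma zmod_closed_mulrz (V : zmodType) (S : set V) (u : V) (k : int) :
  zmod_closed [in S] -> S u -> S (u *~ k).
Proof.
move=> Scl Su; have Sn n : S (u *+ n).
  by rewrite -[n]card_ord -sumr_const; apply: zmod_closed_sum.
case: k => n; first exact: Sn.
rewrite NegzE mulrNz -sub0r; apply: zmod_closed_sub (Scl) _ (Sn _).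
exact: zmod_closed0.
Qed.

(** Injectivity of [fsfun_sum] makes the components of an element unique, and uniqueness makes each
    component additive in the element. *)
Lemma is_grading_proj B : is_grading B ->
  exists pr : G -> {additive A -> A},
  [/\ forall g a, B g (pr g a),
      forall g a, B g a -> pr g a = a,
      forall g h a, B h a -> g != h -> pr g a = 0
    & forall a, exists D, [/\ uniq D, forall g, g \notin D -> pr g a = 0
                            & a = \sum_(g <- D) pr g a] ].
Proof.
case=> Bcl _ [_ inj surj].
have sE a : exists x, direct_sum B x /\ fsfun_sum x = a.
  by have [x] := surj a I; exists x.
have [s /all_and2[sB sK]] := choice sE.
have sP D (c : G -> A) a : uniq D -> (forall g, B g (c g)) ->
    a = \sum_(g <- D) c g -> forall g, s a g = if g \in D then c g else 0.
  move=> uD Bc aE; have [x [xE xsum]] := fsfun_of_seq c uD.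
  suff -> : s a = x by [].
  apply: inj; rewrite ?inE //; last by rewrite sK aE.
  by move=> g; rewrite xE; case: ifP => // _; apply: zmod_closed0.
have prB g : zmod_morphism (fun a => s a g).
  move=> a b /=; pose D := undup (finsupp (s a) ++ finsupp (s b)).
  have uD : uniq D by apply: undup_uniq.
  have inD h : (h \in D) = (h \in finsupp (s a)) || (h \in finsupp (s b)).
    by rewrite mem_undup mem_cat.
  rewrite (sP D (fun h => s a h - s b h)) //; last first.
  - rewrite sumrB -!fsfun_sumE ?sK // => h; rewrite inD => ->//.
    exact: orbT.
  - by move=> h; apply: zmod_closed_sub => //; apply: sB.
  case: ifPn => //; rewrite inD negb_or => /andP[ga gb].
  by rewrite !fsfun_dflt // subrr.
pose pr g : {additive A -> A} :=
  HB.pack (fun a => s a g) (GRing.isZmodMorphism.Build A A _ (prB g)).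
exists pr.
have homE g a h : B g a -> s a h = if h == g then a else 0.
  move=> Bga; rewrite (sP [:: g] (fun h => if h == g then a else 0)) //.
  - by rewrite inE; case: eqP.
  - by move=> k; case: eqP => [->|_] //; apply: zmod_closed0.
  - by rewrite big_seq1 eqxx.
split=> [g a|g a Ba|g h a Ba /negPf gh|a] /=.
- exact: sB.
- by rewrite (homE g) // eqxx.
- by rewrite (homE h) // gh.
- exists (finsupp (s a)); split=> [||]; [exact: fset_uniq| |by rewrite -[LHS]sK].
  by move=> g; apply: fsfun_dflt.
Qed.

(** A pair of a list [D] and a function [c] stands in for a finitely supported family: [c] is
    homogeneous everywhere but counts only on [D]. *)
Lemma is_gradingP B :
  (forall g, zmod_closed [in B g]) ->
  (forall g h a b, B g a -> B h b -> B (g + h) (a * b)) ->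
  (forall a, exists D (c : G -> A),
     [/\ uniq D, forall g, B g (c g) & a = \sum_(g <- D) c g]) ->
  (forall D (c : G -> A), uniq D -> (forall g, B g (c g)) ->
     \sum_(g <- D) c g = 0 -> forall g, g \in D -> c g = 0) ->
  is_grading B.
Proof.
move=> Bcl Bmul Bspan Bdir; split=> //; split=> // [x y|a _].
  rewrite !inE => xB yB xy; apply/fsfunP => g; apply/eqP; rewrite -subr_eq0.
  pose D := undup (finsupp x ++ finsupp y).
  have uD : uniq D by apply: undup_uniq.
  have inD h : (h \in D) = (h \in finsupp x) || (h \in finsupp y).
    by rewrite mem_undup mem_cat.
  have [gD|] := boolP (g \in D); last first.
    by rewrite inD negb_or => /andP[gx gy]; rewrite !fsfun_dflt // subrr.
  apply/eqP/(Bdir D (fun h => x h - y h)) => // [h|].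
    exact: zmod_closed_sub (Bcl h) (xB h) (yB h).
  rewrite sumrB -!fsfun_sumE ?xy ?subrr // => h; rewrite inD => ->//.
  exact: orbT.
have [D [c [uD Bc aE]]] := Bspan a; have [x [xE xsum]] := fsfun_of_seq c uD.
exists x; last by rewrite xsum.
by move=> g; rewrite xE; case: ifP => // _; apply: zmod_closed0.
Qed.

Lemma pushforwardP (H : zmodType) (f : G -> H) B h a :
  (forall g, B g 0) ->
  pushforward f B h a <->
  exists D (c : G -> A),
    [/\ uniq D, forall g, B g (c g), forall g, g \in D -> f g = h
      & a = \sum_(g <- D) c g].
Proof.
move=> B0; split=> [[x [xB xf] <-]|[D [c [uD Bc fD ->]]]].
  exists (finsupp x), x; split=> [|g|g|] //; [exact: fset_uniq|exact: xf].
have [x [xE xsum]] := fsfun_of_seq c uD.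
exists x => //; split=> [g|g].
  by rewrite xE; case: ifP.
by rewrite mem_finsupp xE; case: ifP => [/fD|_ /eqP].
Qed.

End GradingCriteria.

(** * Multiplication matrices of an order *)

Section Coordinates.
Variables (A : comPzRingType) (n : nat).
Variables (phi : {additive A -> 'rV[int]_n}) (psi : 'rV[int]_n -> A).
Hypotheses (phiK : cancel phi psi) (psiK : cancel psi phi).

Let e i := psi (delta_mx 0 i).

Lemma coord_sum a : a = \sum_i e i *~ phi a 0 i.
Proof.
apply: (can_inj phiK); rewrite raddf_sum /= [LHS]row_sum_delta.
by apply: eq_bigr => i _; rewrite raddfMz /= psiK -scaler_int intz.
Qed.

(** Matrices act on row vectors from the right, so a composition of maps becomes the product in
    reverse order. *)
Definition opmx (h : {additive A -> A}) : 'M[int]_n := \matrix_i phi (h (e i)).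

Lemma opmxP (h : {additive A -> A}) a : phi a *m opmx h = phi (h a).
Proof.
rewrite mulmx_sum_row {2}(coord_sum a) !raddf_sum /=; apply: eq_bigr => i _.
by rewrite rowK !raddfMz /= -scaler_int intz.
Qed.

Lemma opmx_uniq (h : {additive A -> A}) (M : 'M[int]_n) :
  (forall a, phi a *m M = phi (h a)) -> M = opmx h.
Proof.
move=> hM; apply/row_matrixP => i; rewrite rowK -hM /e psiK.
by rewrite rowE.
Qed.

Lemma opmx_comp (h k : {additive A -> A}) :
  opmx k *m opmx h = opmx (h \o k : {additive A -> A}).
Proof. by apply: (opmx_uniq (h := h \o k : {additive A -> A})) => a; rewrite mulmxA !opmxP. Qed.

Definition mulmap x : {additive A -> A} := x \*o idfun.

Definition regmx x := opmx (mulmap x).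

Lemma regmxP x a : phi a *m regmx x = phi (x * a).
Proof. exact: opmxP. Qed.

Lemma regmxM x y : regmx (x * y) = regmx x *m regmx y.
Proof.
apply/esym/(opmx_uniq (h := mulmap (x * y))) => a.
by rewrite mulmxA !regmxP mulrCA mulrA.
Qed.

Lemma regmx1 : regmx 1 = 1%:M.
Proof.
by apply/esym/(opmx_uniq (h := mulmap 1)) => a; rewrite mulmx1 /= mul1r.
Qed.

Lemma regmx_is_zmod_morphism : zmod_morphism regmx.
Proof.
move=> x y; apply/row_matrixP => i; rewrite !raddfB /= !rowK -raddfB /=.
by rewrite mulrBl.
Qed.
HB.instance Definition _ :=
  GRing.isZmodMorphism.Build A 'M[int]_n regmx regmx_is_zmod_morphism.

Lemma regmx_inj : injective regmx.
Proof.
by move=> x y xy; apply: (can_inj phiK); rewrite -[x]mulr1 -[y]mulr1 -!regmxP xy.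
Qed.

(* With [P] the projection onto the component of degree [h], multiplication by
   [x] shifts degrees by [g], so [P x P = 0] and [tr (x P) = tr (P x P) = 0]. *)
Lemma regmx_trace0 (G : zmodType) (B : G -> set A) (g : G) x :
  is_grading B -> B g x -> g != 0 -> \tr (regmx x) = 0.
Proof.
move=> gB Bx g0; have [pr [prB pr_id pr0 prD]] := is_grading_proj gB.
have [D DE] := choice prD.
(* One finite list of degrees serves all basis vectors, so the identity of [A] is the sum of the
   projections [pr h] over [E]. *)
pose E := undup (flatten [seq D (e i) | i <- enum 'I_n]).
have eE i : e i = \sum_(h <- E) pr h (e i).
  have [uD D0 eiE] := DE (e i); rewrite [LHS]eiE.
  rewrite [RHS](bigID [in D (e i)]) /= [X in _ = _ + X]big1 ?addr0 //.
  rewrite -[RHS]big_filter; apply: perm_big; apply: uniq_perm => // [|h].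
    by rewrite filter_uniq // undup_uniq.
  rewrite mem_filter andb_idr // => hD; rewrite mem_undup.
  by apply/flatten_mapP; exists i; rewrite // mem_enum.
pose xpr h : {additive A -> A} := mulmap x \o pr h.
have -> : regmx x = \sum_(h <- E) opmx (xpr h).
  apply/row_matrixP => i; rewrite rowK [mulmap x (e i)]/= {1}(eE i) mulr_sumr raddf_sum /=.
  rewrite [RHS]raddf_sum; apply: eq_bigr => h _ /=.
  by rewrite rowK.
rewrite raddf_sum big1 // => h _ /=.
have -> : opmx (xpr h) = opmx (pr h) *m opmx (xpr h).
  rewrite opmx_comp; apply/row_matrixP => i; rewrite !rowK /= /xpr /=.
  by rewrite [pr h (pr h _)]pr_id.
rewrite mxtrace_mulC opmx_comp /=.
suff -> : opmx (pr h \o xpr h : {additive A -> A}) = 0 by rewrite mxtrace0.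
apply/row_matrixP => i; rewrite rowK row0 /= (pr0 h (g + h)) ?raddf0 //.
  by apply: (grading_mul gB) => //; apply: prB.
by rewrite -subr_eq0 opprD addrCA subrr addr0 oppr_eq0.
Qed.

End Coordinates.

(** * Simultaneous diagonalization for a reduced order *)

Section ReducedOrder.
Variables (A : comPzRingType) (n : nat).
Variables (phi : {additive A -> 'rV[int]_n.+1}) (psi : 'rV[int]_n.+1 -> A).
Hypotheses (phiK : cancel phi psi) (psiK : cancel psi phi).
Hypothesis A_red : reduced A.

Local Notation M := (regmx phi psi).
Local Notation Mq x := (map_mx intr (M x) : 'M[rat]_n.+1).
Local Notation Mc x := (map_mx intr (M x) : 'M[algC]_n.+1).

(** Clearing denominators turns a rational polynomial in the matrix of [x] into the matrix of an
    element of [A], to which reducedness applies. *)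
Lemma regmx_horner x (w : {poly rat}) :
  exists (c : int) a, c != 0 /\ c%:~R *: horner_mx (Mq x) w = Mq a.
Proof.
elim/poly_ind: w => [|w k [c [a [c0 wE]]]].
  by exists 1, 0; split=> //; rewrite rmorph0 scaler0 !raddf0.
exists (denq k * c), (a * x *~ denq k + 1 *~ (c * numq k)).
rewrite mulf_neq0 ?denq_neq0 //; split=> //.
have -> : Mq (a * x *~ denq k + 1 *~ (c * numq k)) =
    (denq k)%:~R *: (Mq a *m Mq x) + (c * numq k)%:~R%:M.
  rewrite -map_mxM -(regmxM phiK psiK) 2!raddfD /= !raddfMz /= (regmx1 psiK).
  by rewrite map_mx1 -!scaler_int scalemx1.
have -> : horner_mx (Mq x) (w * 'X + k%:P) =
    horner_mx (Mq x) w *m Mq x + k%:M.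
  by rewrite rmorphD rmorphM /= horner_mx_X horner_mx_C.
rewrite -wE scalerDr !intrM.
rewrite -scalerA -scalemxAl; congr (_ + _).
rewrite scale_scalar_mx -[X in _ * X](divq_num_den k); congr _%:M.
by rewrite [_ * c%:~R]mulrC -mulrA [_ * (_ / _)]mulrC divfK ?intr_eq0 ?denq_neq0.
Qed.

Lemma reduced_sqr0 (a : A) : a * a = 0 -> a = 0.
Proof.
move=> a2; suff: nilradical A a by rewrite A_red.
by exists 2%N; rewrite expr2.
Qed.

(** If the minimal polynomial is [p = r * w ^ 2] with [w] nonconstant, then [(r * w) ^ 2 = r * p]
    vanishes at the matrix. A nonzero multiple of the value of [r * w] is then the matrix of an
    element of square 0, which is 0, so [p] divides [r * w], of smaller degree. *)
Lemma mxminpoly_separable x : separable.separable_poly (mxminpoly (Mq x)).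
Proof.
set p := mxminpoly _; have p0 : p != 0 by apply/monic_neq0/mxminpoly_monic.
apply/separable.separable_polyP; split=> [u v uvp|u _ u1]; last first.
  (* A nonconstant factor has nonzero derivative by characteristic 0: its leading coefficient
     survives. *)
  have [m um] : exists m, size u = m.+2.
    by case: (size u) u1 => [|[|m]] // _; exists m.
  have : (u^`())`_m != 0.
    rewrite coef_deriv mulrn_eq0 /= -[m.+1]/(m.+2.-1) -um -lead_coefE.
    by rewrite lead_coef_eq0 -size_poly_gt0 um.
  by apply: contraNneq => ->; rewrite coef0.
have [u1|u1] := eqVneq (size (gcdp u v)) 1%N; first by rewrite /coprimep u1.
set w := gcdp u v in u1 *.
have /dvdpP[r pE] : w ^+ 2 %| p.
  by apply: dvdp_trans uvp; rewrite expr2 dvdp_mul ?dvdp_gcdl ?dvdp_gcdr.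
have [r0 w0] : r != 0 /\ w != 0.
  by apply/andP; move: p0; rewrite pE mulf_eq0 expf_eq0 negb_or.
have [c [a [c0 aE]]] := regmx_horner x (r * w).
have : p %| r * w.
  apply: mxminpoly_min; suff a0 : a = 0.
    move: aE; rewrite a0 !raddf0 => /eqP.
    by rewrite scaler_eq0 intr_eq0 (negPf c0) => /eqP.
  apply/reduced_sqr0/(regmx_inj phiK psiK).
  suff /matrixP MM0 : Mq (a * a) = 0.
    apply/matrixP => i j; apply/eqP; have := MM0 i j.
    by rewrite raddf0 [LHS]mxE !mxE => /eqP; rewrite intr_eq0.
  rewrite (regmxM phiK psiK) map_mxM -aE -scalemxAl -scalemxAr.
  rewrite mulmxE -rmorphM /=.
  have -> : r * w * (r * w) = r * p by rewrite pE expr2; ring.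
  by rewrite rmorphM /= mx_root_minpoly mulr0 !scaler0.
have rw0 : r * w != 0 by rewrite mulf_neq0.
move=> /(dvdp_leq rw0); rewrite pE expr2 mulrA size_mul //.
by move: u1 rw0 w0; rewrite -!size_poly_gt0; lia.
Qed.

Lemma regmx_diagonalizable x : diagonalizable (Mc x).
Proof.
have -> : Mc x = map_mx ratr (Mq x).
  by apply/matrixP => i j; rewrite !mxE ratr_int.
pose f : {rmorphism rat -> algC} := ratr.
apply/diagonalizableP; rewrite -[ratr]/(f : _ -> _) mxminpoly_map.
have [rs] := closed_field_poly_normal (map_poly f (mxminpoly (Mq x))).
rewrite (monicP _) ?scale1r ?map_monic ?mxminpoly_monic // => pE.
exists rs; rewrite ?pE // -separable.separable_prod_XsubC -pE.
by rewrite separable.separable_map mxminpoly_separable.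
Qed.

(* The [i]th ring homomorphism [A -> algC] reads off the [i]th diagonal entry
   in a basis that diagonalizes all multiplication matrices. *)
Lemma regmx_codiagonalizable :
  exists2 P : 'M[algC]_n.+1, P \in unitmx &
    exists s : A -> 'rV[algC]_n.+1, forall x, P *m Mc x = diag_mx (s x) *m P.
Proof.
pose e i := psi (delta_mx 0 i).
have [] : codiagonalizable [seq Mc (e i) | i <- enum 'I_n.+1].
  apply/codiagonalizableP; split=> [_ _ /mapP[i _ ->] /mapP[j _ ->]|].
    by rewrite /comm_mx -!map_mxM -!(regmxM phiK psiK) mulrC.
  by move=> _ /mapP[i _ ->]; apply: regmx_diagonalizable.
move=> P Pu /allP Pdiag; exists P => //.
have /choice[d dE] i : exists d, P *m Mc (e i) = diag_mx d *m P.
  have /Pdiag /diagonalizable_forPex[d /(simmxP Pu) dE] :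
      Mc (e i) \in [seq Mc (e i) | i <- enum 'I_n.+1].
    by apply: map_f; rewrite mem_enum.
  by exists d.
(* The eigenvalue rows of the basis elements are extended additively to [A]. *)
exists (fun x => \sum_i (phi x 0 i)%:~R *: d i) => x.
rewrite [in LHS](coord_sum phiK psiK x) raddf_sum map_mx_sum mulmx_sumr.
rewrite raddf_sum mulmx_suml; apply: eq_bigr => i _ /=.
rewrite raddfMz raddfMz /= -scaler_int -scalemxAr dE linearZ.
by rewrite /= scalemxAl.
Qed.

End ReducedOrder.

(** * Homomorphisms to [algC] *)

Lemma char_poly_conj_diag (F : fieldType) n (P M : 'M[F]_n) (d : 'rV[F]_n) :
  P \in unitmx -> P *m M = diag_mx d *m P ->
  char_poly M = \prod_i ('X - (d 0 i)%:P).
Proof.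
move=> Pu PM; transitivity (char_poly (diag_mx d)); last first.
  rewrite char_poly_trig ?diag_mx_is_trig //.
  by apply: eq_bigr => i _; rewrite mxE eqxx.
have detP : \det (map_mx polyC P) != 0.
  by rewrite det_map_mx polyC_eq0 -unitfE -unitmxE.
apply: (mulfI detP); rewrite -det_mulmx [RHS]mulrC -det_mulmx /char_poly_mx.
by rewrite mulmxBr mulmxBl -!map_mxM PM mul_mx_scalar mul_scalar_mx.
Qed.

(* The product of the nonzero [d i] is, up to sign, the lowest nonzero
   coefficient of [p]. *)
Lemma int_poly_root_ge1 (p : {poly int}) n (d : 'I_n -> algC) :
  map_poly intr p = \prod_i ('X - (d i)%:P) -> (exists i, d i != 0) ->
  exists i, 1 <= `|d i|.
Proof.
move=> pE [i0 di0]; apply: contrapT => /forallNP d1.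
have {}d1 i : `|d i| < 1.
  rewrite real_ltNge ?normr_real ?real1 //; apply/negP; exact: d1.
pose r := \prod_(i | d i != 0) - d i.
have [k rE] : exists k, r = (p`_k)%:~R.
  exists #|[pred i | d i == 0]|; rewrite -coef_map /= pE.
  rewrite (bigID [pred i | d i == 0]) /=.
  rewrite (eq_bigr (fun=> 'X)) => [|i /eqP->]; last by rewrite subr0.
  rewrite prodr_const coefXnM ltnn subnn -horner_coef0 horner_prod.
  by apply: eq_bigr => i _; rewrite !hornerE.
have r0 : r != 0 by apply/prodf_neq0 => i di; rewrite oppr_eq0.
have : `|r| < 1.
  rewrite normr_prod (bigD1 i0) //= normrN; apply: le_lt_trans (d1 i0).
  rewrite ler_piMr ?normr_ge0 //; apply: prodr_ile1 => i _.
  by rewrite normrN normr_ge0 ltW.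
by rewrite rE -intr_norm ltrz1 ltNge -gtz0_ge1 normr_gt0 -(intr_eq0 algC) -rE r0.
Qed.

(** The row of eigenvalues [s x] is determined by the matrix of [x], so sums and products of
    matrices carry over to the [s i]. The lower bound holds because the characteristic polynomial
    has integer coefficients. *)
Lemma reduced_order_embeddings (A : comPzRingType) :
  is_order A -> reduced A ->
  exists m (s : 'I_m -> A -> algC),
  [/\ forall i, zmod_morphism (s i), forall i, s i 1 = 1,
      forall i x y, s i (x * y) = s i x * s i y,
      forall x, x != 0 -> exists i, 1 <= `|s i x|
    & forall (G : zmodType) (B : G -> set A) g x,
        is_grading B -> B g x -> g != 0 -> \sum_i s i x = 0].
Proof.
case=> -[|n] [phi [psi phiK psiK]] A_red.
  (* Rank 0: [A] is the zero ring and the empty family serves. *)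
  exists 0%N, (fun _ _ => 0); split=> [||||G B g x _ _ _]; try by case.
    by move=> x; rewrite -(inj_eq (can_inj phiK)) !thinmx0 eqxx.
  by rewrite big_ord0.
have [P Pu [s sE]] := regmx_codiagonalizable phiK psiK A_red.
pose M x : 'M[algC]_n.+1 := map_mx intr (regmx phi psi x).
have s_uniq x d : P *m M x = diag_mx d *m P -> s x = d.
  rewrite sE => /(can_inj (mulmxK Pu)) /matrixP sd.
  by apply/rowP => i; have := sd i i; rewrite !mxE eqxx.
exists n.+1, (fun i x => s x 0 i); split=> [i x y|i|i x y|x x0|G B g x gB Bx g0].
- rewrite (s_uniq (x - y) (s x - s y)) ?mxE // /M raddfB map_mxB mulmxBr !sE.
  by rewrite raddfB mulmxBl.
- rewrite (s_uniq 1 (const_mx 1)) ?mxE // /M (regmx1 psiK) map_mx1.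
  by rewrite mulmx1 diag_const_mx mul1mx.
- rewrite (s_uniq (x * y) (\row_j (s x 0 j * s y 0 j))) ?mxE //.
  rewrite /M (regmxM phiK psiK) map_mxM mulmxA sE -mulmxA sE mulmxA.
  by rewrite mulmx_diag.
- apply: (@int_poly_root_ge1 (char_poly (regmx phi psi x))).
    by rewrite map_char_poly (char_poly_conj_diag Pu (sE x)).
  apply: contrapT => /forallNP s0; move/eqP: x0; apply.
  apply: (regmx_inj phiK psiK); rewrite raddf0.
  suff /matrixP M0 : M x = 0.
    apply/matrixP => i j; apply/eqP; have := M0 i j.
    by rewrite [LHS]mxE !mxE => /eqP; rewrite intr_eq0.
  apply: (can_inj (mulKmx Pu)); rewrite sE mulmx0.
  rewrite (_ : s x = 0) ?raddf0 ?mul0mx //.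
  by apply/rowP => i; rewrite mxE; apply/eqP; have /negP := s0 i; rewrite negbK.
- rewrite -mxtrace_diag -[diag_mx _](mulmxK Pu) -sE mxtrace_mulC mulmxA.
  by rewrite mulVmx // mul1mx trace_map_mx (regmx_trace0 phiK psiK gB Bx g0).
Qed.

(** * Degrees that occur in a grading *)

Lemma order_grading_finite (A : comPzRingType) (G : zmodType) (B : G -> set A) :
  is_order A -> is_grading B ->
  exists D : seq G, forall g x, B g x -> x != 0 -> g \in D.
Proof.
case=> n [phi [psi phiK psiK]] gB.
have [pr [prB pr_id pr0 prD]] := is_grading_proj gB.
have [D DE] := choice prD.
exists (flatten [seq D (psi (delta_mx 0 i)) | i <- enum 'I_n]) => g x Bx.
apply: contraNT => /flatten_mapP gD; apply/eqP.
rewrite -(pr_id _ _ Bx) [in LHS](coord_sum phiK psiK x) raddf_sum big1 // => i _.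
rewrite raddfMz /=; have [_ -> //] := DE (psi (delta_mx 0 i)); first by rewrite mul0rz.
by apply/negP => gDi; apply: gD; exists i; rewrite ?mem_enum.
Qed.

Lemma grading_mulX (A : comPzRingType) (G : zmodType) (B : G -> set A) g h x y k :
  is_grading B -> B g x -> B h y -> B (g + h *+ k) (x * y ^+ k).
Proof.
move=> gB Bx By; elim: k => [|k IH]; first by rewrite addr0 expr0 mulr1.
by rewrite mulrSr addrA exprSr mulrA; apply: (grading_mul gB).
Qed.

Lemma reduced_expf_neq0 (A : comPzRingType) (x : A) k :
  reduced A -> x != 0 -> x ^+ k != 0.
Proof.
move=> A_red; move=> x0; apply: contra_neq (x0) => xk0.
suff: nilradical A x by rewrite A_red.
by exists k.
Qed.

(** The powers of [x] are nonzero, so the multiples of [g] lie in a finite list of degrees and two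
    of them coincide. *)
Lemma grading_torsion (A : comPzRingType) (G : zmodType) (B : G -> set A) g x :
  is_order A -> reduced A -> is_grading B -> B g x -> x != 0 ->
  exists2 d, (0 < d)%N & g *+ d = 0.
Proof.
move=> A_ord A_red gB Bx x0.
have [D DP] := order_grading_finite A_ord gB.
(* Exponents start at 1, so nothing about the degree of [1] is used. *)
pose r := [seq g *+ k.+1 | k <- iota 0 (size D).+1].
have /(uniqPn 0)[i [j [ij]]] : ~~ uniq r.
  apply/negP => ru; suff: (size r <= size D)%N by rewrite size_map size_iota ltnn.
  apply: (uniq_leq_size ru) => _ /mapP[k _ ->].
  apply: (DP _ (x ^+ k.+1)); last exact: reduced_expf_neq0.
  by rewrite mulrS exprS; apply: grading_mulX.
rewrite size_map size_iota => jD; rewrite !(nth_map 0%N) ?size_iota //; last first.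
  exact: ltn_trans jD.
rewrite !nth_iota //; last exact: ltn_trans jD.
rewrite !add0n => gij; exists (j - i)%N; first by rewrite subn_gt0.
by rewrite -[(j - i)%N]/(j.+1 - i.+1)%N mulrnBr ?gij ?subrr // ltnS ltnW.
Qed.

(** * The Hermitian form and orthogonality *)

Lemma interpolation (F : fieldType) (r : seq F) (f : F -> F) :
  exists q : {poly F}, {in r, forall t, q.[t] = f t}.
Proof.
elim: r => [|a r [q qr]]; first by exists 0.
have [ar|ar] := boolP (a \in r).
  by exists q => t; rewrite inE => /predU1P[->|]; apply: qr.
(* [p] vanishes at the old nodes, so adding a multiple of it corrects the value at [a] and keeps the
   others. *)
pose p := \prod_(b <- r) ('X - b%:P).
have pa : p.[a] != 0 by rewrite -[_ == 0]/(root p a) root_prod_XsubC.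
exists (q + ((f a - q.[a]) / p.[a]) *: p) => t; rewrite inE !hornerE.
case/predU1P=> [->|tr]; first by rewrite divfK // addrC subrK.
have /rootP -> : root p t by rewrite root_prod_XsubC.
by rewrite mulr0 addr0 qr.
Qed.

Section Orthogonality.
Variables (A : comPzRingType).
Hypotheses (A_ord : is_order A) (A_red : reduced A).
Variables (m : nat) (s : 'I_m -> A -> algC).
Hypotheses (sB : forall i, zmod_morphism (s i)) (s1 : forall i, s i 1 = 1).
Hypothesis sM : forall i x y, s i (x * y) = s i x * s i y.
Hypothesis s_ge1 : forall x, x != 0 -> exists i, 1 <= `|s i x|.
Hypothesis s_tr0 : forall (G : zmodType) (B : G -> set A) g x,
  is_grading B -> B g x -> g != 0 -> \sum_i s i x = 0.

Let s0 i : s i 0 = 0. Proof. by rewrite -(subrr 0) sB subrr. Qed.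
Let sD i x y : s i (x + y) = s i x + s i y.
Proof. by apply: (addIr (- s i y)); rewrite -sB !addrK. Qed.
Let sX i x k : s i (x ^+ k) = s i x ^+ k.
Proof. by elim: k => // k IH; rewrite !exprS sM IH. Qed.

Definition hdot x y := \sum_i s i x * (s i y)^*.

(* On the finitely many values [s i y], the conjugate of [u] is
   [u ^ (d - 1)] times a polynomial in [u ^ d], where [d] kills the degree of
   [y]; so pairing with [y] is a combination of traces of elements whose degree
   is that of [x] minus that of [y]. *)
Lemma hdot_homogeneous (G : zmodType) (B : G -> set A) g h x y :
  is_grading B -> B g x -> B h y -> g != h -> hdot x y = 0.
Proof.
move=> gB Bx By gh; have [->|y0] := eqVneq y 0.
  by rewrite /hdot big1 // => i _; rewrite s0 conjC0 mulr0.
have [[//|d] _ hd] := grading_torsion A_ord A_red gB By y0.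
(* At [t = u ^ d.+1] the root is [|u|], so [u ^ d * F t] is [|u| ^ 2 / u], the conjugate of [u] when
   [u] is nonzero. Here [d.+1] is the number that kills [h]. *)
pose F (t : algC) := (d.+1.-root `|t|) ^+ 2 / t.
have FE u : u^* = u ^+ d * F (u ^+ d.+1).
  have [->|u0] := eqVneq u 0; first by rewrite conjC0 exprS mul0r /F invr0 !mulr0.
  rewrite /F normrX exprCK ?normr_ge0 // normCK.
  move: (u ^+ d) (expf_neq0 d u0) u^* (exprS u d) => v v0 w ->.
  by field; rewrite v0 u0.
have [q qE] := interpolation [seq s i y ^+ d.+1 | i <- enum 'I_m] F.
rewrite /hdot (eq_bigr (fun i => \sum_(k < size q)
    q`_k * s i (x * y ^+ (d + d.+1 * k)))); last first.
  move=> i _; rewrite FE -qE ?horner_coef; last first.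
    by apply: (map_f (fun i => s i y ^+ d.+1)); rewrite mem_enum.
  rewrite !mulr_sumr; apply: eq_bigr => k _.
  by rewrite sM sX exprD -exprM; ring.
rewrite exchange_big big1 //= => k _; rewrite -mulr_sumr.
rewrite (s_tr0 gB (grading_mulX _ gB Bx By)) ?mulr0 //.
(* Since [h *+ d.+1 = 0], the degree of each term is [g - h]. *)
apply: contra_neq gh => ghk; apply/eqP; rewrite -subr_eq0 -[g](addrK (h *+ (d + d.+1 * k))).
by rewrite ghk sub0r -opprD -mulrSr -addSn mulrnDr mulrnA hd mul0rn addr0 oppr0.
Qed.

Lemma hdotDl x y z : hdot (x + y) z = hdot x z + hdot y z.
Proof.
by rewrite -big_split; apply: eq_bigr => i _; rewrite sD mulrDl.
Qed.

Lemma hdotDr x y z : hdot z (x + y) = hdot z x + hdot z y.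
Proof.
by rewrite -big_split; apply: eq_bigr => i _; rewrite sD rmorphD mulrDr.
Qed.

Lemma hdot0l y : hdot 0 y = 0.
Proof. by rewrite /hdot big1 // => i _; rewrite s0 mul0r. Qed.

Lemma hdotC x y : hdot y x = (hdot x y)^*.
Proof.
rewrite /hdot rmorph_sum; apply: eq_bigr => i _.
by rewrite rmorphM /= conjCK mulrC.
Qed.

Lemma hdot_ge1 x : x != 0 -> 1 <= hdot x x.
Proof.
move=> /s_ge1[i si]; rewrite /hdot (bigD1 i) //= -normCK.
apply: le_trans (_ : `|s i x| ^+ 2 <= _); first exact: exprn_ege1.
by rewrite lerDl sumr_ge0 // => j _; rewrite mul_conjC_ge0.
Qed.

Lemma hdot_ge0 x : 0 <= hdot x x.
Proof. by apply: sumr_ge0 => j _; rewrite mul_conjC_ge0. Qed.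

(** Pythagoras: [x - pr g x] is the sum of the other components, each orthogonal to [pr g x]. *)
Lemma hdot_comp (G : zmodType) (B : G -> set A) (pr : G -> {additive A -> A}) g x D :
  is_grading B -> (forall g x, B g (pr g x)) -> uniq D ->
  x = \sum_(h <- D) pr h x -> g \in D ->
  hdot x x = hdot (pr g x) (pr g x) + hdot (x - pr g x) (x - pr g x).
Proof.
move=> gB prB uD xE gD; set y := pr g x; set z := x - y.
have yz : hdot z y = 0.
  rewrite /z [X in X - _]xE (bigD1_seq g) //= addrC addrK.
  apply: (big_ind (fun t => hdot t y = 0)); first exact: hdot0l.
    by move=> a b ay by0; rewrite hdotDl ay by0 addr0.
  by move=> h hg; apply: (hdot_homogeneous gB (prB h x) (prB g x)).
have -> : x = y + z by rewrite /z addrC subrK.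
clearbody z.
by rewrite hdotDl !hdotDr yz (hdotC z y) yz conjC0 addr0 add0r.
Qed.

End Orthogonality.

(** * Elements homogeneous in every grading *)

Definition universally_homogeneous (A : comPzRingType) (a : A) :=
  forall (G : zmodType) (B : G -> set A), is_grading B -> exists g, B g a.

(* If [a] is not homogeneous for some grading, split off one of its components:
   both parts have strictly smaller norm, by a margin of at least [1]. *)
Lemma universally_homogeneous_sum (A : comPzRingType) (a : A) :
  is_order A -> reduced A ->
  exists l : seq A,
    (forall b, b \in l -> b != 0 /\ universally_homogeneous b) /\
    a = \sum_(b <- l) b.
Proof.
move=> A_ord A_red.
have [m [s [sB s1 sM s_ge1 s_tr0]]] := reduced_order_embeddings A_ord A_red.
have [k] : exists k : nat, hdot s a a < k%:R.
  exists (Num.bound (hdot s a a)); apply: archi_boundP; exact: hdot_ge0.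
elim: k a => [|k IH] a ak; first by have := le_lt_trans (hdot_ge0 s a) ak; rewrite ltxx.
have [a_hom|a_nhom] := pselect (universally_homogeneous a).
  have [->|a0] := eqVneq a 0; first by exists [::]; rewrite big_nil.
  by exists [:: a]; rewrite big_seq1; split=> // b; rewrite inE => /eqP ->.
have [G [B [gB a_nB]]] : exists (G : zmodType) (B : G -> set A),
    is_grading B /\ forall g, ~ B g a.
  apply: contrapT => nGB; apply: a_nhom => G B gB; apply: contrapT => nBa.
  by apply: nGB; exists G, B; split=> // g Ba; apply: nBa; exists g.
have [pr [prB pr_id pr0 prD]] := is_grading_proj gB.
have [D [uD D0 aE]] := prD a.
(* Both parts are nonzero: if all components vanished, [a = 0] would be homogeneous, and a zero
   remainder would put [a] in [B g]. *)
have [g gD ag] : exists2 g, g \in D & pr g a != 0.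
  apply: contrapT => nD; apply: (a_nB 0).
  rewrite aE big_seq big1 => [|g gD].
    exact: (zmod_closed0 (grading_subgroup gB 0)).
  by apply/eqP; apply: contrapT => /negP ag; apply: nD; exists g.
have a'0 : a - pr g a != 0.
  by rewrite subr_eq0; apply/eqP => ag'; apply: (a_nB g); rewrite ag'.
have aa := hdot_comp A_ord A_red sB s1 sM s_tr0 gB prB uD aE gD.
have a1 := hdot_ge1 s_ge1 ag; have a'1 := hdot_ge1 s_ge1 a'0.
move: ak; rewrite aa -[k.+1]addn1 natrD => ak.
have [l [lP lE]] : exists l : seq A,
    (forall b, b \in l -> b != 0 /\ universally_homogeneous b) /\
    pr g a = \sum_(b <- l) b.
  by apply: IH; rewrite -(ltrD2r 1); apply: le_lt_trans ak; rewrite lerD2l.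
have [l' [l'P l'E]] : exists l : seq A,
    (forall b, b \in l -> b != 0 /\ universally_homogeneous b) /\
    a - pr g a = \sum_(b <- l) b.
  apply: IH; rewrite -(ltrD2r 1); apply: le_lt_trans ak.
  by rewrite addrC lerD2r.
exists (l ++ l'); split=> [b|].
  by rewrite mem_cat => /orP[/lP|/l'P].
by rewrite big_cat /= -lE -l'E addrC subrK.
Qed.

Lemma grading_degree_unique (A : comPzRingType) (G : zmodType) (B : G -> set A)
    g h x :
  is_grading B -> B g x -> B h x -> x != 0 -> g = h.
Proof.
move=> gB Bg Bh x0; have [pr [_ pr_id pr0 _]] := is_grading_proj gB.
by apply/eqP; apply: contraNT x0 => gh; rewrite -(pr_id g x Bg) (pr0 g h).
Qed.

(** The form [hdot] does not depend on a grading, so each pair may be separated by its own grading: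
    pairing the sum with [c i] leaves only the norm of [c i]. *)
Lemma separated_sum0 (A : comPzRingType) (I : eqType) (D : seq I) (c : I -> A) :
  is_order A -> reduced A ->
  (forall i j, i != j -> exists (G : zmodType) (B : G -> set A) g h,
     [/\ is_grading B, B g (c i), B h (c j) & g != h]) ->
  uniq D -> \sum_(i <- D) c i = 0 -> forall i, i \in D -> c i = 0.
Proof.
move=> A_ord A_red csep uD c0 i iD.
have [m [s [sB s1 sM s_ge1 s_tr0]]] := reduced_order_embeddings A_ord A_red.
apply/eqP; apply: contraT => /(hdot_ge1 s_ge1).
suff -> : hdot s (c i) (c i) = hdot s (\sum_(i <- D) c i) (c i).
  by rewrite c0 hdot0l // ler10.
rewrite (bigD1_seq i) //= hdotDl // [X in _ = _ + X](_ : _ = 0) ?addr0 //.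
apply: (big_ind (fun t => hdot s t (c i) = 0)); first exact: hdot0l.
  by move=> a b a0 b0; rewrite hdotDl // a0 b0 addr0.
move=> j /csep[G [B [g [h [gB Bg Bh gh]]]]].
exact: hdot_homogeneous gB Bg Bh gh.
Qed.

(** * Integer combinations and homogeneous generators *)

Section IntegerCombinations.
Variables (G : zmodType) (m : nat) (t : 'I_m -> G).

Definition int_comb (v : 'rV[int]_m) : G := \sum_i t i *~ v 0 i.

Lemma int_comb_is_zmod_morphism : zmod_morphism int_comb.
Proof.
by move=> u v; rewrite /int_comb -sumrB; apply: eq_bigr => i _;
   rewrite !mxE mulrzBr.
Qed.
HB.instance Definition _ :=
  GRing.isZmodMorphism.Build 'rV[int]_m G int_comb int_comb_is_zmod_morphism.

Lemma int_comb_delta i : int_comb (delta_mx 0 i) = t i.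
Proof.
rewrite /int_comb (bigD1 i) //= big1 => [|j ji]; first by rewrite mxE !eqxx addr0.
by rewrite mxE eqxx (negPf ji).
Qed.

Lemma int_comb_closed : zmod_closed [in range int_comb].
Proof.
apply: zmod_closedP => [|_ _ [u _ <-] [v _ <-]].
  by exists 0; rewrite ?raddf0.
by exists (u - v); rewrite ?raddfB.
Qed.

Lemma int_comb_finite : (forall i, exists2 d, (0 < d)%N & t i *+ d = 0) ->
  finite_set (range int_comb).
Proof.
move=> t_tors.
have /choice[d dP] i : exists d, (0 < d)%N /\ t i *+ d = 0.
  by have [d d0 td] := t_tors i; exists d.
(* [M] bounds every [d i], so coefficients reduced modulo the [d i] lie in one finite type. *)
pose M := (\sum_i d i)%N.
pose F (c : {ffun 'I_m -> 'I_M.+1}) := \sum_i t i *+ c i.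
apply: (@sub_finite_set _ _ (range F)); last exact/finite_image/finite_finset.
move=> _ [v _ <-]; pose k i : int := v 0 i.
exists [ffun i => inord `|(k i %% d i)%Z|%N] => //.
apply: eq_bigr => i _; have [di0 tdi] := dP i; rewrite -/(k i).
have mod_ge0 : 0 <= (k i %% d i)%Z by rewrite modz_ge0 // eqz_nat -lt0n.
rewrite ffunE inordK; last first.
  rewrite ltnS -lez_nat gez0_abs // (le_trans (ltW (ltz_pmod _ _))) //.
  by rewrite lez_nat /M (bigD1 i) //= leq_addr.
rewrite [in RHS](divz_eq (k i) (d i)) mulrzDr mulrC mulrzA.
by rewrite -[_ *~ d i]pmulrn tdi mul0rz add0r -[in RHS](gez0_abs mod_ge0) -pmulrn.
Qed.

End IntegerCombinations.

Lemma order_homogeneous_generators (A : comPzRingType) :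
  is_order A -> reduced A ->
  exists m (t : 'I_m -> A),
    (forall i, t i != 0 /\ universally_homogeneous (t i)) /\
    forall a, exists v, int_comb t v = a.
Proof.
move=> A_ord A_red; have [n [phi [psi phiK psiK]]] := A_ord.
have [l lE] := choice (fun i => universally_homogeneous_sum
                                  (psi (delta_mx 0 i)) A_ord A_red).
pose L := flatten [seq l i | i <- enum 'I_n].
exists (size L), (tnth (in_tuple L)); split=> [i|a].
  have /flatten_mapP[j _ lj] := mem_tnth i (in_tuple L).
  by have [+ _] := lE j; apply.
have Scl := int_comb_closed (tnth (in_tuple L)).
suff [v _ <-] : range (int_comb (tnth (in_tuple L))) a by exists v.
rewrite (coord_sum phiK psiK a); apply: zmod_closed_sum => // i _.
apply: zmod_closed_mulrz => //; have [_ ->] := lE i.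
rewrite big_seq; apply: zmod_closed_sum => // b bl.
have /tnthP[j ->] : b \in in_tuple L.
  by apply/flatten_mapP; exists i; rewrite ?mem_enum.
by exists (delta_mx 0 j); rewrite ?int_comb_delta.
Qed.

(** * Construction of the universal grading *)

Lemma additive_eq_delta (G Q : zmodType) m (p : {additive 'rV[int]_m -> Q})
    (f g : {additive Q -> G}) :
  (forall q, exists v, p v = q) ->
  (forall i, f (p (delta_mx 0 i)) = g (p (delta_mx 0 i))) -> f =1 g.
Proof.
move=> psurj fg q; have [v <-] := psurj q; rewrite (row_sum_delta v).
rewrite !raddf_sum /=; apply: eq_bigr => i _.
by rewrite -[v 0 i]intz scaler_int !raddfMz /= fg.
Qed.

(* [Gamma] is the quotient of the free abelian group on the generators [t i] by
   all relations that hold between their degrees in every grading; the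
   component of degree [q] consists of the elements that lie in the component
   prescribed by [q] in every grading. *)
Lemma exists_universal_grading (A : comPzRingType) :
  is_order A -> reduced A ->
  exists (Gamma : zmodType) (B : Gamma -> set A), is_universal_grading B.
Proof.
move=> A_ord A_red.
have [m [t [tP t_gen]]] := order_homogeneous_generators A_ord A_red.
pose N : set 'rV[int]_m := [set v | forall (G : zmodType) (B : G -> set A)
  (g : 'I_m -> G), is_grading B -> (forall i, B (g i) (t i)) ->
  int_comb g v = 0].
have Ncl : zmod_closed [in N].
  apply: zmod_closedP => [G B g gB gt|u v Nu Nv G B g gB gt].
    by rewrite raddf0.
  by rewrite raddfB /= (Nu _ B) // (Nv _ B) // subrr.
have [Q [p [psurj pker]]] := zmod_quotient Ncl.
pose del i := p (delta_mx 0 i).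
have deg_map (G : zmodType) (B : G -> set A) (g : 'I_m -> G) : is_grading B ->
    (forall i, B (g i) (t i)) ->
    exists f : {additive Q -> G}, forall v, f (p v) = int_comb g v.
  by move=> gB gt; apply: additive_factor => // v /pker/(_ G B g gB gt).
(* A compatible [f] sends the formal degree [del i] of each generator to its actual degree in
   [B]. *)
pose compat (G : zmodType) (B : G -> set A) (f : {additive Q -> G}) :=
  forall i, B (f (del i)) (t i).
have compatP (G : zmodType) (B : G -> set A) : is_grading B -> exists f, compat G B f.
  move=> gB; have /choice[g gt] i : exists g, B g (t i).
    by have [_ /(_ G B gB)] := tP i.
  have [f fE] := deg_map G B g gB gt.
  by exists f => i; rewrite fE int_comb_delta.
pose U q : set A := [set x | forall (G : zmodType) (B : G -> set A)
  (f : {additive Q -> G}), is_grading B -> compat G B f -> B (f q) x].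
have tU i : U (del i) (t i) by move=> G B f _; apply.
have Ucl q : zmod_closed [in U q].
  apply: zmod_closedP => [G B f gB _|x y Ux Uy G B f gB fB].
    exact: zmod_closed0 (grading_subgroup gB _).
  have Bcl := grading_subgroup gB (f q).
  exact: zmod_closed_sub Bcl (Ux _ _ _ gB fB) (Uy _ _ _ gB fB).
have gU : is_grading U.
  apply: is_gradingP => // [q r x y Ux Uy G B f gB fB|a|D c uD cU].
  - by rewrite raddfD; apply: (grading_mul gB) (Ux _ _ _ _ _) (Uy _ _ _ _ _).
  (* The terms of a combination are grouped by [del i]; several generators may share a class, hence
     [undup]. *)
  - have [v <-] := t_gen a; pose D := undup [seq del i | i <- enum 'I_m].
    exists D, (fun q => \sum_(i | del i == q) t i *~ v 0 i); split=> [|q|].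
    + exact: undup_uniq.
    + apply: zmod_closed_sum => // i /eqP <-; exact: zmod_closed_mulrz (Ucl _) (tU i).
    rewrite (exchange_big_dep xpredT) //=; apply: eq_bigr => i _.
    have iD : del i \in D by rewrite mem_undup map_f ?mem_enum.
    rewrite big_mkcond (bigD1_seq _ iD) ?undup_uniq //= eqxx big1 ?addr0 // => q.
    by rewrite eq_sym => /negPf ->.
  - apply: separated_sum0 => // q r qr.
    (* A lift of [q - r] is not a relation, so it fails in some grading, and there [f q] and [f r]
       differ. *)
    have [v vqr] := psurj (q - r).
    have : ~ N v by move/pker; rewrite vqr => /eqP; rewrite subr_eq0 (negPf qr).
    move=> /existsNP[G /existsNP[B /existsNP[g /not_implyP[gB /not_implyP[gt]]]]].
    move=> gv; have [f fE] := deg_map G B g gB gt.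
    have fB : compat G B f by move=> i; rewrite fE int_comb_delta.
    exists G, B, (f q), (f r); split=> //; [exact: cU|exact: cU|].
    by rewrite -subr_eq0 -raddfB -vqr fE; apply/eqP.
have U0 q : U q 0 by apply: zmod_closed0.
exists Q, U; split=> // G C gC; have [f fC] := compatP G C gC.
exists f; split=> [|g CE].
  apply/funext => d; apply/seteqP; split=> x.
    have [pr [prB pr_id pr0 _]] := is_grading_proj gC.
    have [_ _ [_ _ /(_ x I)[z zU <-]]] := gU.
    move=> Cz; apply/pushforwardP => //.
    exists [seq q <- finsupp z | f q == d], z; split=> [|q|q|].
    - by rewrite filter_uniq // fset_uniq.
    - exact: zU.
    - by rewrite mem_filter => /andP[/eqP].
    (* Projecting onto [C d] keeps the components of [x] with [f q = d] and kills the others. *)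
    - rewrite -[LHS](pr_id _ _ Cz) raddf_sum big_filter [RHS]big_mkcond.
      apply: eq_bigr => q _ /=; have zC : C (f q) (z q) by apply: zU.
      by case: eqP => [<-|/eqP fqd]; [apply: pr_id|rewrite (pr0 _ (f q)) // eq_sym].
  move=> /(pushforwardP _ _ _ U0)[D [c [uD cU fD ->]]].
  rewrite big_seq; apply: zmod_closed_sum; first exact: grading_subgroup.
  by move=> q /fD <-; apply: cU.
(* The nonzero element [t i] has degree [f (del i)] and also [g (del i)] in [C], so these agree, and
   the [del i] generate [Q]. *)
apply: (additive_eq_delta psurj) => i; have [ti0 _] := tP i.
apply: (grading_degree_unique gC _ (fC i) ti0).
rewrite CE; apply/pushforwardP => //.
exists [:: del i], (fun q => if q == del i then t i else 0); split=> [//|q|q|].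
- by case: eqP => [->|].
- by rewrite inE => /eqP ->.
- by rewrite big_seq1 eqxx.
Qed.

(** * Finiteness of the universal group *)

Section UniversalFinite.
Variables (A : comPzRingType) (G : zmodType) (B : G -> set A).
Hypothesis gB : is_grading B.

Definition trivial_grading (Q : zmodType) (q : Q) : set A :=
  [set x | q = 0 \/ x = 0].

Lemma trivial_grading_is_grading (Q : zmodType) : is_grading (@trivial_grading Q).
Proof.
apply: is_gradingP => [q|q r x y|a|D c uD cB].
- apply: zmod_closedP => [|x y]; first by right.
  by move=> [q0|->] [q0'|->]; try (by left); right; rewrite subrr.
- move=> [->|->]; last by right; rewrite mul0r.
  by move=> [->|->]; [left; rewrite addr0|right; rewrite mulr0].
- exists [:: 0], (fun q => if q == 0 then a else 0); split=> // [q|].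
    by case: eqP => [->|_]; [left|right].
  by rewrite big_seq1 eqxx.
move=> c0 q qD; have [q0|/eqP q0] := eqVneq q 0; last by case: (cB q).
rewrite -[RHS]c0 (bigD1_seq q) //= big1 ?addr0 // => r rq.
by case: (cB r) => // r0; rewrite r0 q0 eqxx in rq.
Qed.

Lemma pushforward_trivial (Q : zmodType) (u : G -> Q) :
  (forall g x, B g x -> x != 0 -> u g = 0) ->
  @trivial_grading Q = pushforward u B.
Proof.
move=> uB; have B0 g : B g 0 by apply: zmod_closed0 (grading_subgroup gB g).
have [pr [prB _ _ prD]] := is_grading_proj gB.
apply/funext => q; apply/seteqP; split=> x.
  move=> qx; apply/pushforwardP => //; have [D [uD _ xE]] := prD x.
  have [q0|/eqP q0] := eqVneq q 0; last first.
    by case: qx => // ->; exists [::], (fun=> 0); rewrite big_nil.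
  exists [seq g <- D | pr g x != 0], (pr^~ x); split=> [|g|g|] //.
  - by rewrite filter_uniq.
  - by rewrite mem_filter q0 => /andP[gx _]; apply: uB gx.
  - rewrite {1}xE big_filter [RHS]big_mkcond; apply: eq_bigr => g _.
    by case: eqP.
move=> /(pushforwardP _ _ _ B0)[D [c [uD cB uD' ->]]].
have [q0|/eqP q0] := eqVneq q 0; [by left|right].
rewrite big_seq big1 // => g gD; apply/eqP; apply: contra_notT q0 => cg.
by rewrite -(uD' g gD); apply: uB (cB g) cg.
Qed.

End UniversalFinite.

Lemma universal_grading_finite (A : comPzRingType) (G : zmodType)
    (B : G -> set A) :
  is_order A -> reduced A -> is_universal_grading B -> finite_set [set: G].
Proof.
move=> A_ord A_red [gB univ].
have [E EP] := order_grading_finite A_ord gB.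
(* [E] may list degrees whose component is 0, and these are not known to be torsion; only occurring
   degrees are kept. *)
pose D := [seq g <- E | `[< exists2 x, B g x & x != 0 >]].
have DP g x : B g x -> x != 0 -> g \in D.
  move=> Bx x0; rewrite mem_filter (EP g x) // andbT.
  by apply/asboolP; exists x.
pose t := tnth (in_tuple D).
have t_tors i : exists2 d, (0 < d)%N & t i *+ d = 0.
  have := mem_tnth i (in_tuple D); rewrite mem_filter => /andP[/asboolP[x Bx x0] _].
  exact: grading_torsion Bx x0.
suff GE : [set: G] `<=` range (int_comb t).
  exact: sub_finite_set GE (int_comb_finite t_tors).
have [Q [p [psurj pker]]] := zmod_quotient (int_comb_closed t).
have [f [_ f_uniq]] := univ Q _ (trivial_grading_is_grading A Q).
(* [p] and the zero map both kill every occurring degree, so uniqueness makes them equal and the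
   kernel of [p] is all of [G]. *)
have pf : p =1 f.
  apply: f_uniq; apply: (pushforward_trivial gB) => g x Bx x0; apply/pker.
  have /tnthP[i ->] : g \in in_tuple D by apply: DP Bx x0.
  by exists (delta_mx 0 i); rewrite ?int_comb_delta.
have zf : (\0 : {additive G -> Q}) =1 f.
  by apply: f_uniq; apply: (pushforward_trivial gB).
by move=> g _; apply/pker; rewrite pf -zf.
Qed.

Theorem theorem1p3 (A : comPzRingType) (hord : is_order A) (hred : reduced A) :
  (exists (Gamma : zmodType) (B : Gamma -> set A), is_universal_grading B) /\
  (forall (Gamma : zmodType) (B : Gamma -> set A),
     is_universal_grading B -> finite_set [set: Gamma]%classic).
Proof.
split; first exact: exists_universal_grading.
by move=> Gamma B; apply: universal_grading_finite.
Qed.
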